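(* The structural completion $\widetilde{\mathsf{IPC}}$ of $\mathsf{IPC}$ is hereditarily structurally complete.
   Context: Formulas are built from a countably infinite set of variables with the connectives $\wedge,\vee,\to,\neg$. A rule is a pair $\Gamma/A$ with $\Gamma$ a finite (possibly empty) set of formulas and $A$ a formula. A deductive system is a pair $S=\langle Ax,R\rangle$ of a nonempty set of formulas and a nonempty set of rules. For finite $\Gamma$, $\Gamma\vdash_S A$ means there is a sequence $B_1,\dots,B_n=A$ where each $B_i$ is in $\Gamma$, or is a substitution instance of a formula of $Ax$, or there is a substitution instance $\Delta/B_i$ of a rule in $R$ with $\Delta\subseteq\{B_1,\dots,B_{i-1}\}$. $L(S)=\{A:\ \vdash_S A\}$ is the logic of $S$. $S'$ is a deductive extension of $S$ if $\vdash_S\subseteq\vdash_{S'}$. A rule $r$ is admissible in $S=\langle Ax,R\rangle$ if $L(\langle Ax,R\cup\{r\}\rangle)=L(S)$; $\Gamma/A$ is derivable in $S$ if $\Gamma\vdash_S A$. The structural completion of $S$ is $\widetilde{S}=\langle Ax,\widetilde{R}(S)\rangle$, where $\widetilde{R}(S)$ is the set of all rules admissible in $S$. $S$ is structurally complete if every rule admissible in $S$ is derivable in $S$; it is hereditarily structurally complete if it is structurally complete and every deductive extension of it is structurally complete. $\mathsf{IPC}=\langle Ax^i,\{\mathsf{mp}\}\rangle$, where $Ax^i$ is a standard set of axiom schemes of intuitionistic propositional calculus and $\mathsf{mp}$ is Modus Ponens $A, A\to B/B$; so $L(\mathsf{IPC})$ is intuitionistic propositional logic. *)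

(* Defs.v *)
From Stdlib Require Import List.
Import ListNotations.

Inductive form : Type :=
| Var (n : nat)
| And (A B : form)
| Or (A B : form)
| Imp (A B : form)
| Neg (A : form).

Fixpoint subst (s : nat -> form) (A : form) : form :=
  match A with
  | Var n => s n
  | And A B => And (subst s A) (subst s B)
  | Or A B => Or (subst s A) (subst s B)
  | Imp A B => Imp (subst s A) (subst s B)
  | Neg A => Neg (subst s A)
  end.

(* The finite premise set is represented by a list; order and multiplicity are
   irrelevant, since premises are only ever used through [In] and [incl]. *)
Definition rule : Type := (list form * form)%type.

Record system : Type := System {
  Ax : form -> Prop;
  Rules : rule -> Prop;
  Ax_nonempty : exists A, Ax A;
  Rules_nonempty : exists r, Rules r
}.

Definition justified (S : system) (Gamma prev : list form) (B : form) : Prop :=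
  In B Gamma
  \/ (exists (s : nat -> form) (C : form), Ax S C /\ B = subst s C)
  \/ (exists (s : nat -> form) (Delta : list form) (C : form),
        Rules S (Delta, C) /\ B = subst s C /\ incl (map (subst s) Delta) prev).

Definition is_derivation (S : system) (Gamma Bs : list form) : Prop :=
  forall (prev : list form) (B : form) (next : list form),
    Bs = prev ++ B :: next -> justified S Gamma prev B.

Definition derives (S : system) (Gamma : list form) (A : form) : Prop :=
  exists Bs : list form, is_derivation S Gamma (Bs ++ [A]).

Definition logic (S : system) (A : form) : Prop := derives S [] A.

Definition deductive_extension (S S' : system) : Prop :=
  forall (Gamma : list form) (A : form), derives S Gamma A -> derives S' Gamma A.

Definition add_rule (S : system) (r : rule) : system :=
  {| Ax := Ax S;
     Rules := fun r' => Rules S r' \/ r' = r;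
     Ax_nonempty := Ax_nonempty S;
     Rules_nonempty := ex_intro _ r (or_intror eq_refl) |}.

Definition admissible (S : system) (r : rule) : Prop :=
  forall A : form, logic (add_rule S r) A <-> logic S A.

Definition derivable (S : system) (r : rule) : Prop := derives S (fst r) (snd r).

Definition structurally_complete (S : system) : Prop :=
  forall r : rule, admissible S r -> derivable S r.

Definition hereditarily_structurally_complete (S : system) : Prop :=
  structurally_complete S
  /\ forall S' : system, deductive_extension S S' -> structurally_complete S'.

Lemma derives_rules_mono (S S' : system) :
  (forall A, Ax S A -> Ax S' A) -> (forall r, Rules S r -> Rules S' r) ->
  deductive_extension S S'.
Proof.
intros HA HR Gamma A [Bs H]; exists Bs.
intros prev B next E.
destruct (H prev B next E) as [HB | [[s [C [HC E1]]] | [s [D [C [HC E1]]]]]].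
- now left.
- right; left; exists s, C; auto.
- right; right; exists s, D, C; auto.
Qed.

Lemma rules_admissible (S : system) (r : rule) : Rules S r -> admissible S r.
Proof.
intros Hr A; split; apply derives_rules_mono; simpl; auto.
intros r' [H | ->]; assumption.
Qed.

Lemma admissible_nonempty (S : system) : exists r, admissible S r.
Proof.
destruct (Rules_nonempty S) as [r Hr].
exists r; apply rules_admissible; exact Hr.
Qed.

Definition structural_completion (S : system) : system :=
  {| Ax := Ax S;
     Rules := admissible S;
     Ax_nonempty := Ax_nonempty S;
     Rules_nonempty := admissible_nonempty S |}.

(* Axiom schemes are given by formulas in three variables, their instances being
   obtained by substitution in [justified]. *)
Definition ipc_axioms : list form :=
  let p := Var 0 in
  let q := Var 1 in
  let r := Var 2 in
  [ Imp p (Imp q p);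
    Imp (Imp p (Imp q r)) (Imp (Imp p q) (Imp p r));
    Imp (And p q) p;
    Imp (And p q) q;
    Imp p (Imp q (And p q));
    Imp p (Or p q);
    Imp q (Or p q);
    Imp (Imp p r) (Imp (Imp q r) (Imp (Or p q) r));
    Imp (Imp p q) (Imp (Imp p (Neg q)) (Neg p));
    Imp (Neg p) (Imp p q) ].

Definition modus_ponens : rule := ([Var 0; Imp (Var 0) (Var 1)], Var 1).

Definition IPC : system :=
  {| Ax := fun A => In A ipc_axioms;
     Rules := fun r => r = modus_ponens;
     Ax_nonempty := ex_intro _ _ (or_introl eq_refl);
     Rules_nonempty := ex_intro _ modus_ponens eq_refl |}.

(* Main.v *)
(* For a finite, subformula-closed set L of formulas, the L-type of a world of
   a Kripke model is the set of members of L it forces. A finite set X of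
   types, all containing Gamma, is extendible if under any family of types from
   X one can put a root whose type is again in X. A substitution unifying Gamma
   realises an extendible set of types (glue models below a new root), so with
   P_X := "all types above belong to X", the rule Gamma / \/_X P_X (X
   extendible) is admissible in IPC and hence derivable in every extension S of
   the completion. Each P_X is projective: it has a unifier s with
   P_X |- B <-> s B, obtained by iterating Ghilardi's substitutions
   x |-> P_X -> x (x in t), x |-> P_X /\ x (x not in t), for t in X. Hence if
   Gamma / B is admissible in S, then S proves s Gamma, thus s B, thus P_X -> B
   for every extendible X, and therefore derives B from Gamma. *)
Require Import Defs.
From Stdlib Require Import Arith List Lia Classical ClassicalEpsilon IndefiniteDescription.
Import ListNotations.

(** * Derivations *)

(** Trades derivation sequences for rule induction. The inner claim walks along the sequence, with
    the invariant that every formula of the processed prefix satisfies [P]. *)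
Lemma derives_ind (S : system) (Gamma : list form) (P : form -> Prop) :
  (forall A, In A Gamma -> P A) ->
  (forall s C, Ax S C -> P (subst s C)) ->
  (forall s Delta C, Rules S (Delta, C) ->
     (forall D, In D Delta -> P (subst s D)) -> P (subst s C)) ->
  forall A, derives S Gamma A -> P A.
Proof.
intros Hhyp Hax Hrule A [Bs H].
assert (Hall : forall next prev, (forall B, In B prev -> P B) ->
  Bs ++ [A] = prev ++ next -> forall B, In B next -> P B).
{ induction next as [|C next IH]; intros prev Hprev E B HB; [destruct HB|].
  assert (HC : P C).
  { destruct (H prev C next E) as [HC | [[s [D [HD ->]]] | [s [Delta [D [HD [-> Hi]]]]]]].
    - now apply Hhyp.
    - now apply Hax.
    - apply Hrule with Delta; [exact HD|].
      intros F HF; apply Hprev, Hi, in_map, HF. }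
  destruct HB as [<-|HB]; [exact HC|].
  apply IH with (prev := prev ++ [C]).
  - intros F HF; apply in_app_or in HF as [HF|[<-|[]]]; auto.
  - now rewrite <- app_assoc.
  - exact HB. }
apply (Hall (Bs ++ [A]) []); [intros B []|reflexivity|].
apply in_or_app; right; now left.
Qed.

Lemma justified_incl (S : system) (Gamma prev prev' : list form) (B : form) :
  incl prev prev' -> justified S Gamma prev B -> justified S Gamma prev' B.
Proof.
intros Hi [H | [H | [s [D [C [H1 [H2 H3]]]]]]].
- now left.
- now right; left.
- right; right; exists s, D, C; repeat split; auto.
  eapply incl_tran; eauto.
Qed.

Lemma is_derivation_nil (S : system) (Gamma : list form) : is_derivation S Gamma [].
Proof. intros prev B next E; destruct prev; discriminate. Qed.

Lemma is_derivation_app (S : system) (Gamma Bs Cs : list form) :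
  is_derivation S Gamma Bs -> is_derivation S Gamma Cs ->
  is_derivation S Gamma (Bs ++ Cs).
Proof.
intros HB HC prev B next E.
apply app_eq_app in E as [l [[E1 E2]|[E1 E2]]].
- destruct l as [|D l].
  + rewrite app_nil_r in E1; simpl in E2.
    apply justified_incl with []; [intros x []|].
    now apply (HC [] B next).
  + injection E2 as -> _. now apply HB with l.
- apply justified_incl with l; [rewrite E1; apply incl_appr, incl_refl|].
  now apply HC with next.
Qed.

Lemma derives_justified (S : system) (Gamma Bs : list form) (A : form) :
  is_derivation S Gamma Bs -> justified S Gamma Bs A -> derives S Gamma A.
Proof.
intros HB HA; exists Bs; intros prev B next E.
destruct (exists_last (l := B :: next)) as [l [x Ex]]; [discriminate|].
rewrite Ex, app_assoc in E; apply app_inj_tail in E as [E <-].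
destruct l as [|C l].
- injection Ex as -> ->. rewrite app_nil_r in E; now subst.
- injection Ex as -> ->. now apply HB with l.
Qed.

Lemma derives_hyp (S : system) (Gamma : list form) (A : form) :
  In A Gamma -> derives S Gamma A.
Proof.
intros H; apply derives_justified with []; [apply is_derivation_nil|now left].
Qed.

Lemma derives_ax (S : system) (Gamma : list form) (s : nat -> form) (C : form) :
  Ax S C -> derives S Gamma (subst s C).
Proof.
intros H; apply derives_justified with []; [apply is_derivation_nil|].
right; left; eauto.
Qed.

Lemma derives_rule (S : system) (Gamma : list form) (s : nat -> form)
    (Delta : list form) (C : form) :
  Rules S (Delta, C) -> (forall D, In D Delta -> derives S Gamma (subst s D)) ->
  derives S Gamma (subst s C).
Proof.
intros HR HD.
assert (H : exists Bs, is_derivation S Gamma Bs /\ incl (map (subst s) Delta) Bs).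
{ clear HR; induction Delta as [|D Delta IH].
  - exists []; split; [apply is_derivation_nil|intros x []].
  - destruct IH as [Bs [H1 H2]]; [intros E HE; apply HD; now right|].
    destruct (HD D (or_introl eq_refl)) as [Cs HCs].
    exists ((Cs ++ [subst s D]) ++ Bs); split.
    + now apply is_derivation_app.
    + intros x [<-|Hx]; apply in_or_app; [left|right; now apply H2].
      apply in_or_app; right; now left. }
destruct H as [Bs [H1 H2]].
apply derives_justified with Bs; [exact H1|].
right; right; exists s, Delta, C; auto.
Qed.

Lemma derives_cut (S : system) (Gamma Delta : list form) (A : form) :
  (forall D, In D Delta -> derives S Gamma D) -> derives S Delta A ->
  derives S Gamma A.
Proof.
intros HD; revert A; apply derives_ind; [exact HD| |].
- intros s C; apply derives_ax.
- intros s Th C HC IH; now apply derives_rule with Th.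
Qed.

Lemma derives_incl (S : system) (Gamma Delta : list form) (A : form) :
  incl Gamma Delta -> derives S Gamma A -> derives S Delta A.
Proof. intros Hi; apply derives_cut; intros D HD; apply derives_hyp, Hi, HD. Qed.

(** Turns admissibility into a statement about unifiers. Forwards, the new rule is applied once to
    theorems of [S]; backwards, the theorems of [S] are closed under the new rule, so induction on
    derivations eliminates it. *)
Lemma admissible_iff (S : system) (Gamma : list form) (A : form) :
  admissible S (Gamma, A) <->
  forall s, (forall G, In G Gamma -> logic S (subst s G)) -> logic S (subst s A).
Proof.
split.
- intros H s HG; apply H.
  apply derives_rule with Gamma; [now right|].
  intros G HGG; apply H, HG, HGG.
- intros H B; split.
  + revert B; apply derives_ind.
    * intros B [].
    * intros s C HC; exact (derives_ax S [] s C HC).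
    * intros s Delta C [HC|HC] IH.
      -- exact (derives_rule S [] s Delta C HC IH).
      -- injection HC as -> ->; now apply H.
  + apply derives_rules_mono; simpl; auto.
Qed.

(** * Intuitionistic derivability *)

Definition inst3 (A B C : form) (n : nat) : form :=
  match n with 0 => A | 1 => B | _ => C end.

Ltac ipc_axiom A B C k :=
  let H := fresh in
  assert (H : In (nth k ipc_axioms (Var 0)) ipc_axioms)
    by (apply nth_In; simpl; lia);
  exact (derives_ax IPC _ (inst3 A B C) _ H).

Lemma ipc_mp (Gamma : list form) (A B : form) :
  derives IPC Gamma A -> derives IPC Gamma (Imp A B) -> derives IPC Gamma B.
Proof.
intros HA HAB.
apply (derives_rule IPC Gamma (inst3 A B B) [Var 0; Imp (Var 0) (Var 1)] (Var 1)).
- reflexivity.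
- intros D [<-|[<-|[]]]; assumption.
Qed.

Lemma ipc_k (Gamma : list form) (A B : form) : derives IPC Gamma (Imp A (Imp B A)).
Proof. ipc_axiom A B B 0. Qed.

Lemma ipc_s (Gamma : list form) (A B C : form) :
  derives IPC Gamma (Imp (Imp A (Imp B C)) (Imp (Imp A B) (Imp A C))).
Proof. ipc_axiom A B C 1. Qed.

(** The deduction theorem. It rests on modus ponens being the only rule of [IPC]: the rule case is
    one use of the distribution axiom. *)
Lemma ipc_imp_intro (Gamma : list form) (A B : form) :
  derives IPC (A :: Gamma) B -> derives IPC Gamma (Imp A B).
Proof.
assert (HK : forall C, derives IPC Gamma C -> derives IPC Gamma (Imp A C)).
{ intros C HC; eapply ipc_mp; [exact HC|apply ipc_k]. }
revert B; apply derives_ind.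
- intros B [<-|HB]; [|now apply HK, derives_hyp].
  eapply ipc_mp; [apply (ipc_k _ A A)|].
  eapply ipc_mp; [apply (ipc_k _ A (Imp A A))|apply ipc_s].
- intros s C HC; now apply HK, derives_ax.
- intros s Delta C HC IH; injection HC as -> ->.
  eapply ipc_mp; [apply (IH (Var 0)); now left|].
  eapply ipc_mp; [apply (IH (Imp (Var 0) (Var 1))); now right; left|apply ipc_s].
Qed.

Lemma ipc_and_l (Gamma : list form) (A B : form) :
  derives IPC Gamma (And A B) -> derives IPC Gamma A.
Proof. intros H; eapply ipc_mp; [exact H|]; ipc_axiom A B B 2. Qed.

Lemma ipc_and_r (Gamma : list form) (A B : form) :
  derives IPC Gamma (And A B) -> derives IPC Gamma B.
Proof. intros H; eapply ipc_mp; [exact H|]; ipc_axiom A B B 3. Qed.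

Lemma ipc_and_intro (Gamma : list form) (A B : form) :
  derives IPC Gamma A -> derives IPC Gamma B -> derives IPC Gamma (And A B).
Proof.
intros HA HB; eapply ipc_mp; [exact HB|].
eapply ipc_mp; [exact HA|]; ipc_axiom A B B 4.
Qed.

Lemma ipc_or_l (Gamma : list form) (A B : form) :
  derives IPC Gamma A -> derives IPC Gamma (Or A B).
Proof. intros H; eapply ipc_mp; [exact H|]; ipc_axiom A B B 5. Qed.

Lemma ipc_or_r (Gamma : list form) (A B : form) :
  derives IPC Gamma B -> derives IPC Gamma (Or A B).
Proof. intros H; eapply ipc_mp; [exact H|]; ipc_axiom A B B 6. Qed.

Lemma ipc_or_elim (Gamma : list form) (A B C : form) :
  derives IPC Gamma (Or A B) -> derives IPC (A :: Gamma) C ->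
  derives IPC (B :: Gamma) C -> derives IPC Gamma C.
Proof.
intros HAB HA HB; eapply ipc_mp; [exact HAB|].
eapply ipc_mp; [exact (ipc_imp_intro _ _ _ HB)|].
eapply ipc_mp; [exact (ipc_imp_intro _ _ _ HA)|]; ipc_axiom A B C 7.
Qed.

Lemma ipc_neg_intro (Gamma : list form) (A B : form) :
  derives IPC (A :: Gamma) B -> derives IPC (A :: Gamma) (Neg B) ->
  derives IPC Gamma (Neg A).
Proof.
intros HB HN; eapply ipc_mp; [exact (ipc_imp_intro _ _ _ HN)|].
eapply ipc_mp; [exact (ipc_imp_intro _ _ _ HB)|]; ipc_axiom A B B 8.
Qed.

Lemma ipc_neg_elim (Gamma : list form) (A B : form) :
  derives IPC Gamma A -> derives IPC Gamma (Neg A) -> derives IPC Gamma B.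
Proof.
intros HA HN; eapply ipc_mp; [exact HA|].
eapply ipc_mp; [exact HN|]; ipc_axiom A B B 9.
Qed.

(** * Kripke semantics *)

Record frame : Type := Frame {
  world :> Type;
  le : world -> world -> Prop;
  le_refl : forall w, le w w;
  le_trans : forall u v w, le u v -> le v w -> le u w
}.
Arguments le {f}.
Arguments le_refl {f}.
Arguments le_trans {f}.

Definition persistent {F : frame} (V : F -> nat -> Prop) : Prop :=
  forall v w n, le v w -> V v n -> V w n.

Fixpoint forces {F : frame} (V : F -> nat -> Prop) (w : F) (A : form) : Prop :=
  match A with
  | Var n => V w n
  | And A B => forces V w A /\ forces V w B
  | Or A B => forces V w A \/ forces V w B
  | Imp A B => forall v, le w v -> forces V v A -> forces V v B
  | Neg A => forall v, le w v -> ~ forces V v A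
  end.

Definition pull {F : frame} (s : nat -> form) (V : F -> nat -> Prop) : F -> nat -> Prop :=
  fun w n => forces V w (s n).

Lemma forces_mono {F : frame} (V : F -> nat -> Prop) (A : form) (v w : F) :
  persistent V -> le v w -> forces V v A -> forces V w A.
Proof.
intros HV; revert v w; induction A as [n|A IHA B IHB|A IHA B IHB|A IHA B IHB|A IHA];
  simpl; intros v w Hvw.
- now apply HV.
- intros [HA HB]; eauto.
- intros [HA|HB]; eauto.
- intros H u Hu; apply H; eapply le_trans; eauto.
- intros H u Hu; apply H; eapply le_trans; eauto.
Qed.

Lemma forces_subst {F : frame} (V : F -> nat -> Prop) (s : nat -> form) (A : form) (w : F) :
  forces V w (subst s A) <-> forces (pull s V) w A.
Proof.
revert w; induction A as [n|A IHA B IHB|A IHA B IHB|A IHA B IHB|A IHA]; simpl; intros w.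
- reflexivity.
- now rewrite IHA, IHB.
- now rewrite IHA, IHB.
- split; intros H v Hv HA; apply IHB, H, IHA, HA; exact Hv.
- split; intros H v Hv HA; apply (H v Hv), IHA, HA.
Qed.

Lemma pull_persistent {F : frame} (V : F -> nat -> Prop) (s : nat -> form) :
  persistent V -> persistent (pull s V).
Proof. intros HV v w n; apply forces_mono, HV. Qed.

Lemma forces_agree {F : frame} (V V' : F -> nat -> Prop) (A : form) (w : F) :
  (forall v n, le w v -> (V v n <-> V' v n)) -> (forces V w A <-> forces V' w A).
Proof.
revert w; induction A as [n|A IHA B IHB|A IHA B IHB|A IHA B IHB|A IHA]; simpl; intros w HV.
- apply HV, le_refl.
- now rewrite IHA, IHB.
- now rewrite IHA, IHB.
- assert (HV' : forall v, le w v -> forall u n, le v u -> (V u n <-> V' u n))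
    by (intros v Hv u n Hu; apply HV; eapply le_trans; eauto).
  split; intros H v Hv HA; apply (IHB v (HV' v Hv)), H, (IHA v (HV' v Hv)), HA; exact Hv.
- assert (HV' : forall v, le w v -> forall u n, le v u -> (V u n <-> V' u n))
    by (intros v Hv u n Hu; apply HV; eapply le_trans; eauto).
  split; intros H v Hv HA; apply (H v Hv), (IHA v (HV' v Hv)), HA.
Qed.

Lemma ipc_sound (Gamma : list form) (A : form) :
  derives IPC Gamma A ->
  forall (F : frame) (V : F -> nat -> Prop) (w : F), persistent V ->
  (forall G, In G Gamma -> forces V w G) -> forces V w A.
Proof.
intros HA F V w HV HG; revert A HA; apply derives_ind.
- exact HG.
(* An instance of an axiom under [V] is the axiom itself under the pulled valuation, so only the ten
   schemes in three variables have to be checked. *)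
- intros s C HC; apply forces_subst.
  pose proof (pull_persistent V s HV) as Hm; unfold persistent in Hm.
  simpl in HC; repeat (destruct HC as [<-|HC]); [..|destruct HC];
    cbn [forces]; intros; try split; intuition eauto 8 using le_refl, le_trans.
  exfalso; apply (H0 v0); auto.
- intros s Delta C HC IH; injection HC as -> ->.
  apply (IH (Imp (Var 0) (Var 1)) (or_intror (or_introl eq_refl)) w (le_refl w)).
  apply (IH (Var 0)); now left.
Qed.

(** * Canonical model and strong completeness *)

Definition closed (L : list form) : Prop :=
  forall C, In C L ->
  match C with
  | Var _ => True
  | And A B | Or A B | Imp A B => In A L /\ In B L
  | Neg A => In A L
  end.

Fixpoint subforms (A : form) : list form :=
  A :: match A with
       | Var _ => []
       | And B C | Or B C | Imp B C => subforms B ++ subforms C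
       | Neg B => subforms B
       end.

Lemma subforms_refl (A : form) : In A (subforms A).
Proof. destruct A; now left. Qed.

Lemma closed_app (L L' : list form) : closed L -> closed L' -> closed (L ++ L').
Proof.
intros H H' C HC; apply in_app_or in HC as [HC|HC]; [apply H in HC|apply H' in HC];
  destruct C; rewrite ?in_app_iff; tauto.
Qed.

Lemma closed_cons (A : form) (L : list form) :
  closed L ->
  match A with
  | Var _ => True
  | And B C | Or B C | Imp B C => In B L /\ In C L
  | Neg B => In B L
  end -> closed (A :: L).
Proof.
intros H HA C [<-|HC]; [|apply H in HC; destruct C; simpl; tauto].
destruct A; simpl; tauto.
Qed.

Lemma closed_subforms (A : form) : closed (subforms A).
Proof.
induction A as [n|A IHA B IHB|A IHA B IHB|A IHA B IHB|A IHA]; simpl;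
  apply closed_cons; auto using closed_app, subforms_refl; try (intros C []);
  split; apply in_or_app; auto using subforms_refl.
Qed.

Definition closure (Gamma : list form) : list form := flat_map subforms Gamma.

Lemma closed_closure (Gamma : list form) : closed (closure Gamma).
Proof.
induction Gamma as [|A Gamma IH]; [intros C []|].
apply closed_app; [apply closed_subforms|exact IH].
Qed.

Lemma incl_closure (Gamma : list form) : incl Gamma (closure Gamma).
Proof. intros A HA; apply in_flat_map; exists A; split; [exact HA|apply subforms_refl]. Qed.

(** [Delta] stands for the consistent theory it generates. The disjunction property is asked only
    for disjunctions in [L], so that finite lists can serve as worlds. *)
Definition prime (L Delta : list form) : Prop :=
  (exists C, ~ derives IPC Delta C) /\
  (forall C D, In (Or C D) L -> derives IPC Delta (Or C D) ->
     derives IPC Delta C \/ derives IPC Delta D).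

(** A finite Lindenbaum construction: run through [L] and add each formula unless [B] would become
    derivable. Then every member of [L] is derivable or entails [B]; if both disjuncts of a
    derivable disjunction entailed [B], so would the context. *)
Lemma prime_extension (L Gamma : list form) (B : form) :
  closed L -> ~ derives IPC Gamma B ->
  exists Delta, prime L Delta /\ incl Gamma Delta /\ ~ derives IPC Delta B.
Proof.
intros HL HB.
assert (H : forall l, exists Delta, incl Gamma Delta /\ ~ derives IPC Delta B /\
  forall C, In C l -> derives IPC Delta C \/ derives IPC (C :: Delta) B).
{ induction l as [|C l [Delta [H1 [H2 H3]]]].
  - exists Gamma; repeat split; [apply incl_refl|exact HB|intros C []].
  - destruct (classic (derives IPC (C :: Delta) B)) as [HC|HC].
    + exists Delta; repeat split; auto. intros D [<-|HD]; auto.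
    + exists (C :: Delta); repeat split; auto using incl_tl.
      intros D [<-|HD]; [left; apply derives_hyp; now left|].
      destruct (H3 D HD) as [HD'|HD']; [left|right];
        (eapply derives_incl; [|exact HD']); intros E; simpl; tauto. }
destruct (H L) as [Delta [H1 [H2 H3]]]; exists Delta; repeat split; auto; [now exists B|].
intros C D HCD HD; destruct (HL _ HCD) as [HCL HDL].
destruct (H3 C HCL) as [HC|HC]; [now left|].
destruct (H3 D HDL) as [HD'|HD']; [now right|].
contradict H2; now apply ipc_or_elim with C D.
Qed.

(** The order is inclusion of the generated theories, not of the lists. *)
Definition canonical_frame (L : list form) : frame.
Proof.
refine (Frame {Delta : list form | prime L Delta}
  (fun D E => forall C, derives IPC (proj1_sig D) C -> derives IPC (proj1_sig E) C) _ _).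
- auto.
- auto.
Defined.

Definition canonical_val (L : list form) : canonical_frame L -> nat -> Prop :=
  fun D n => derives IPC (proj1_sig D) (Var n).

Lemma canonical_truth (L : list form) (A : form) (w : canonical_frame L) :
  closed L -> In A L -> (forces (canonical_val L) w A <-> derives IPC (proj1_sig w) A).
Proof.
intros HL; revert w; induction A as [n|A IHA B IHB|A IHA B IHB|A IHA B IHB|A IHA];
  intros w HA; pose proof (HL _ HA) as HS; cbn [forces].
- reflexivity.
- destruct HS as [HSA HSB]; rewrite IHA, IHB by assumption; split.
  + intros [H1 H2]; now apply ipc_and_intro.
  + intros H; split; [eapply ipc_and_l|eapply ipc_and_r]; exact H.
- destruct HS as [HSA HSB]; rewrite IHA, IHB by assumption; split.
  + intros [H|H]; [now apply ipc_or_l|now apply ipc_or_r].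
  + destruct w as [D [HD1 HD2]]; now apply HD2.
- destruct HS as [HSA HSB]; split.
  + intros H; apply NNPP; intros HN.
    destruct (prime_extension L (A :: proj1_sig w) B HL) as [D [HD [Hi HB]]].
    { intros HB; apply HN, ipc_imp_intro, HB. }
    apply HB; apply (IHB (exist _ D HD) HSB); apply H.
    * intros C HC; apply derives_incl with (proj1_sig w); [|exact HC].
      intros x Hx; apply Hi; now right.
    * apply (IHA (exist _ D HD) HSA), derives_hyp, Hi; now left.
  + intros H v Hv HvA; apply IHB; [exact HSB|].
    apply ipc_mp with A; [now apply IHA|now apply Hv].
- split.
  + intros H; apply NNPP; intros HN.
    (* If adding [A] made the context inconsistent, [Neg A] would already be derivable. *)
    assert (HC : exists C, ~ derives IPC (A :: proj1_sig w) C).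
    { apply not_all_ex_not; intros HC; apply HN.
      apply ipc_neg_intro with (Var 0); apply HC. }
    destruct HC as [C HC].
    destruct (prime_extension L _ C HL HC) as [D [HD [Hi _]]].
    apply (H (exist _ D HD)).
    * intros E HE; apply derives_incl with (proj1_sig w); [|exact HE].
      intros x Hx; apply Hi; now right.
    * apply (IHA (exist _ D HD) HS), derives_hyp, Hi; now left.
  + intros H v Hv HvA; destruct (proj2_sig v) as [[C HC] _]; apply HC.
    apply ipc_neg_elim with A; [now apply IHA|now apply Hv].
Qed.

(** From here on, derivability in [IPC] is established by arguments about Kripke models. *)
Lemma ipc_complete (Gamma : list form) (A : form) :
  (forall (F : frame) (V : F -> nat -> Prop) (w : F), persistent V ->
     (forall G, In G Gamma -> forces V w G) -> forces V w A) ->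
  derives IPC Gamma A.
Proof.
intros H; apply NNPP; intros HA.
set (L := closure (A :: Gamma)).
assert (HL : closed L) by apply closed_closure.
assert (Hi : incl (A :: Gamma) L) by apply incl_closure.
destruct (prime_extension L Gamma A HL HA) as [D [HD [HG HN]]].
apply HN, (canonical_truth L A (exist _ D HD) HL (Hi A (or_introl eq_refl))).
apply H.
- intros v w n Hvw; apply Hvw.
- intros G HGG; apply canonical_truth; [exact HL|apply Hi; now right|].
  apply derives_hyp, HG, HGG.
Qed.

(** * Types over a finite set of formulas *)

(** Filtering by an arbitrary proposition, decided classically; it allows finite lists to be cut out
    by conditions that quantify over models. *)
Definition cfilter {T : Type} (P : T -> Prop) (l : list T) : list T :=
  filter (fun x => if excluded_middle_informative (P x) then true else false) l.

Lemma in_cfilter {T : Type} (P : T -> Prop) (l : list T) (x : T) :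
  In x (cfilter P l) <-> In x l /\ P x.
Proof.
unfold cfilter; rewrite filter_In.
destruct (excluded_middle_informative (P x)); intuition discriminate.
Qed.

Lemma cfilter_cons {T : Type} (P : T -> Prop) (x : T) (l : list T) :
  (P x /\ cfilter P (x :: l) = x :: cfilter P l) \/
  (~ P x /\ cfilter P (x :: l) = cfilter P l).
Proof.
unfold cfilter; simpl; destruct (excluded_middle_informative (P x)); auto.
Qed.

Lemma length_cfilter_le {T : Type} (P Q : T -> Prop) (l : list T) :
  (forall x, P x -> Q x) -> length (cfilter P l) <= length (cfilter Q l).
Proof.
intros H; induction l as [|x l IH]; [auto|].
destruct (cfilter_cons P x l) as [[HP ->]|[HP ->]];
  destruct (cfilter_cons Q x l) as [[HQ ->]|[HQ ->]]; simpl; auto with arith.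
now apply H in HP.
Qed.

(** A finite set that contains another and is no larger equals it; this is the counting step of
    [theta_round]. *)
Lemma length_cfilter_eq {T : Type} (P Q : T -> Prop) (l : list T) :
  (forall x, P x -> Q x) -> length (cfilter Q l) <= length (cfilter P l) ->
  forall x, In x l -> Q x -> P x.
Proof.
intros H; induction l as [|y l IH]; intros Hl x Hx HQx; [destruct Hx|].
pose proof (length_cfilter_le P Q l H) as Hle.
destruct (cfilter_cons P y l) as [[HP E1]|[HP E1]];
  destruct (cfilter_cons Q y l) as [[HQ E2]|[HQ E2]]; rewrite E1, E2 in Hl;
  simpl in Hl; try lia; try (now apply H in HP); destruct Hx as [<-|Hx]; auto; try tauto; apply IH; auto; lia.
Qed.

Fixpoint sublists {T : Type} (l : list T) : list (list T) :=
  match l with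
  | [] => [[]]
  | x :: l => map (cons x) (sublists l) ++ sublists l
  end.

Lemma cfilter_sublists {T : Type} (P : T -> Prop) (l : list T) :
  In (cfilter P l) (sublists l).
Proof.
induction l as [|x l IH]; [now left|].
destruct (cfilter_cons P x l) as [[_ ->]|[_ ->]]; simpl; apply in_or_app; auto.
left; now apply in_map.
Qed.

(** The language has no constants, so [Imp (Var 0) (Var 0)] serves as verum here and its negation as
    falsum in [bigor]. *)
Definition bigand (l : list form) : form :=
  fold_right And (Imp (Var 0) (Var 0)) l.

Definition bigor (l : list form) : form :=
  fold_right Or (Neg (Imp (Var 0) (Var 0))) l.

Lemma forces_bigand {F : frame} (V : F -> nat -> Prop) (w : F) (l : list form) :
  forces V w (bigand l) <-> forall A, In A l -> forces V w A.
Proof.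
induction l as [|B l IH]; simpl.
- split; [intros _ A []|auto].
- rewrite IH; split; [intros [H1 H2] A [<-|HA]; auto|auto].
Qed.

Lemma forces_bigor {F : frame} (V : F -> nat -> Prop) (w : F) (l : list form) :
  forces V w (bigor l) <-> exists A, In A l /\ forces V w A.
Proof.
induction l as [|B l IH]; simpl.
- split; [intros H; destruct (H w (le_refl w)); auto|intros [A [[] _]]].
- rewrite IH; split.
  + intros [H|[A [H1 H2]]]; eauto.
  + intros [A [[<-|HA] H]]; eauto.
Qed.

Definition has_type (L : list form) {F : frame} (V : F -> nat -> Prop) (w : F)
    (t : list form) : Prop :=
  forall C, In C L -> (In C t <-> forces V w C).

Definition same_type (L t u : list form) : Prop :=
  forall C, In C L -> (In C t <-> In C u).

Definition type_at (L : list form) {F : frame} (V : F -> nat -> Prop) (w : F) : list form :=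
  cfilter (forces V w) L.

Lemma has_type_at (L : list form) {F : frame} (V : F -> nat -> Prop) (w : F) :
  has_type L V w (type_at L V w).
Proof. intros C HC; unfold type_at; rewrite in_cfilter; tauto. Qed.

(* A world refutes the conjunct indexed by [t] at some successor exactly when
   that successor has type [t]. *)
Definition typed_in (L : list form) (X : list (list form)) : form :=
  bigand (map (fun t => Imp (bigand t) (bigor (cfilter (fun C => ~ In C t) L)))
    (cfilter (fun t => ~ exists u, In u X /\ same_type L t u) (sublists L))).

Lemma forces_typed_in (L : list form) (X : list (list form)) {F : frame}
    (V : F -> nat -> Prop) (w : F) :
  forces V w (typed_in L X) <->
  forall v, le w v -> exists t, In t X /\ has_type L V v t.
Proof.
unfold typed_in; rewrite forces_bigand; split.
- intros H v Hv; apply NNPP; intros HN.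
  assert (Hn : ~ exists u, In u X /\ same_type L (type_at L V v) u).
  { intros [u [Hu Hs]]; apply HN; exists u; split; [exact Hu|].
    intros C HC; rewrite <- (Hs C HC); now apply has_type_at. }
  (* The type of [v] matches nothing in [X], so it indexes a conjunct. The premise of that conjunct
     holds at [v], so [v] would force a formula outside its own type. *)
  assert (Ht : forces V v (bigor (cfilter (fun C => ~ In C (type_at L V v)) L))).
  { refine (H (Imp (bigand (type_at L V v)) _) _ v Hv _).
    - apply in_map_iff; exists (type_at L V v); split; [reflexivity|].
      apply in_cfilter; split; [apply cfilter_sublists|exact Hn].
    - apply forces_bigand; intros A HA; now apply in_cfilter in HA. }
  apply forces_bigor in Ht as [A [HA HF]]; apply in_cfilter in HA as [HA HA'].
  now apply HA', has_type_at.
- intros H A HA; apply in_map_iff in HA as [t [<- Ht]].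
  apply in_cfilter in Ht as [Ht Hn]; intros v Hv HF.
  rewrite forces_bigand in HF.
  destruct (H v Hv) as [u [Hu HT]].
  apply forces_bigor, NNPP; intros HE; apply Hn; exists u; split; [exact Hu|].
  intros C HC; split; intros HCt.
  + apply HT; auto.
  + apply NNPP; intros HCn; apply HE; exists C; split.
    * now apply in_cfilter.
    * now apply HT.
Qed.

(** * Projectivity *)

(* [root_type L Y t]: [t] can be the type of a world all of whose proper
   successors have types in [Y], where every type in [Y] occurs. *)
Definition root_type (L : list form) (Y : list form -> Prop) (t : list form) : Prop :=
  forall C, In C L ->
  match C with
  | Var _ => In C t -> forall u, Y u -> In C u
  | And A B => In C t <-> In A t /\ In B t
  | Or A B => In C t <-> In A t \/ In B t
  | Imp A B => In C t <-> (In A t -> In B t) /\ forall u, Y u -> In C u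
  | Neg A => In C t <-> ~ In A t /\ forall u, Y u -> In C u
  end.

(** [Y] may be empty, so an extendible [X] contains the type of a world without proper successors;
    in particular it is nonempty. *)
Definition extendible (L Gamma : list form) (X : list (list form)) : Prop :=
  (forall t, In t X -> incl Gamma t) /\
  forall Y : list form -> Prop, (forall u, Y u -> In u X) ->
    exists t, In t X /\ root_type L Y t.

(** Ghilardi's substitution. Where [P] holds it changes nothing; at a world refuting [P], variables
    outside [t] become false, and a variable in [t] becomes true exactly when all worlds above that
    force [P] force it. *)
Definition theta (P : form) (t : list form) (n : nat) : form :=
  if excluded_middle_informative (In (Var n) t) then Imp P (Var n) else And P (Var n).

Lemma pull_theta_agree {F : frame} (V : F -> nat -> Prop) (P : form) (t : list form) (w : F) :
  persistent V -> forces V w P ->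
  forall v n, le w v -> (pull (theta P t) V v n <-> V v n).
Proof.
intros HV HP v n Hv; unfold pull, theta.
assert (HPv : forces V v P) by (eapply forces_mono; eauto).
destruct (excluded_middle_informative (In (Var n) t)); simpl.
- split; [intros H; apply H; auto using le_refl|].
  intros H u Hu _; now apply HV with v.
- tauto.
Qed.

Lemma forces_pull_theta {F : frame} (V : F -> nat -> Prop) (P : form) (t : list form)
    (w : F) (A : form) :
  persistent V -> forces V w P ->
  (forces (pull (theta P t) V) w A <-> forces V w A).
Proof. intros HV HP; apply forces_agree; intros; now apply pull_theta_agree with w. Qed.

(** Only worlds forcing [P] count. The substitutions [theta] leave these worlds unchanged, so the
    seen types can only increase. *)
Definition seen (L : list form) (X : list (list form)) {F : frame} (V : F -> nat -> Prop)
    (w : F) (t : list form) : Prop :=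
  In t X /\ exists v, le w v /\ forces V v (typed_in L X) /\ has_type L V v t.

Section Step.
Variables (L : list form) (X : list (list form)).
Hypothesis L_closed : closed L.
Let P : form := typed_in L X.
Variables (F : frame) (V : F -> nat -> Prop).
Hypothesis V_persistent : persistent V.

Lemma seen_anti (v w : F) (t : list form) : le v w -> seen L X V w t -> seen L X V v t.
Proof.
intros Hvw [Ht [u [Hu H]]]; split; [exact Ht|]; exists u; split; [|exact H].
eapply le_trans; eauto.
Qed.

Lemma seen_pull (u : list form) (w : F) (t : list form) :
  seen L X V w t -> seen L X (pull (theta P u) V) w t.
Proof.
intros [Ht [v [Hv [HP HT]]]]; split; [exact Ht|]; exists v; repeat split; auto.
- now apply forces_pull_theta.
- intros HC; apply forces_pull_theta, HT; auto.
- intros HC; apply HT; auto; now apply forces_pull_theta in HC.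
Qed.

(** When all worlds above [w] refuting [P] see the same types as [w], the substitution gives each of
    them the type [t], which fits as a root below these types. Worlds forcing [P] keep their types,
    so afterwards every type above [w] lies in [X]. *)
Lemma theta_step (w : F) (t : list form) :
  (forall v, le w v -> ~ forces V v P -> forall u, seen L X V w u -> seen L X V v u) ->
  In t X -> root_type L (seen L X V w) t ->
  forces (pull (theta P t) V) w P.
Proof.
intros Hsame Ht Hroot.
assert (HP : forall v, forces V v P -> exists u, In u X /\ has_type L V v u).
{ intros v Hv; exact (proj1 (forces_typed_in L X V v) Hv v (le_refl v)). }
assert (Hseen : forall v, le w v -> forces V v P ->
  exists u, seen L X V w u /\ has_type L V v u).
{ intros v Hv HPv; destruct (HP v HPv) as [u [Hu HT]]; exists u; split; [|exact HT].
  split; [exact Hu|]; exists v; auto. }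
(* [Hin] and [Hout] are the two halves of the interplay with worlds forcing [P]: formulas common to
   all seen types hold there, and a formula holding at a refuting world passes upwards to witnesses
   of all seen types. *)
assert (Hin : forall v C, le w v -> forces V v P -> In C L ->
  (forall u, seen L X V w u -> In C u) -> forces V v C).
{ intros v C Hv HPv HC Hu; destruct (Hseen v Hv HPv) as [u [Hsu HT]].
  apply HT; auto. }
assert (Hout : forall v C, le w v -> ~ forces V v P -> In C L ->
  forces (pull (theta P t) V) v C -> forall u, seen L X V w u -> In C u).
{ intros v C Hv HPv HC HF u Hu; apply (Hsame v Hv HPv) in Hu.
  destruct Hu as [_ [r [Hr [HPr HT]]]]; apply HT; [exact HC|].
  rewrite <- forces_pull_theta by eassumption.
  eapply forces_mono; [apply pull_persistent, V_persistent|exact Hr|exact HF]. }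
assert (Htype : forall C, In C L -> forall v, le w v -> ~ forces V v P ->
  (In C t <-> forces (pull (theta P t) V) v C)).
{ induction C as [n|A IHA B IHB|A IHA B IHB|A IHA B IHB|A IHA]; intros HC v Hv HPv;
    pose proof (L_closed _ HC) as HL; pose proof (Hroot _ HC) as HR;
    cbv beta iota in HL, HR; cbn [forces].
  - unfold pull, theta.
    destruct (excluded_middle_informative (In (Var n) t)) as [Hn|Hn]; simpl; [|tauto].
    split; [|auto]; intros _ r Hr HPr; apply (Hin r (Var n)); auto.
    eapply le_trans; eauto.
  - destruct HL as [HLA HLB]; rewrite HR, (IHA HLA v), (IHB HLB v); tauto.
  - destruct HL as [HLA HLB]; rewrite HR, (IHA HLA v), (IHB HLB v); tauto.
  - destruct HL as [HLA HLB]; rewrite HR; split.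
    + intros [H1 H2] r Hr HA.
      assert (Hwr : le w r) by (eapply le_trans; eauto).
      (* A successor forcing [P] is settled by the seen types, one refuting [P] by the induction
         hypothesis. *)
      destruct (classic (forces V r P)) as [HPr|HPr].
      * apply forces_pull_theta in HA; auto; apply forces_pull_theta; auto.
        apply (Hin r _ Hwr HPr HC H2 r (le_refl r) HA).
      * apply (IHB HLB r), H1, (IHA HLA r); auto.
    + intros H; split.
      * intros HA; apply (IHB HLB v); auto; apply H, (IHA HLA v); auto using le_refl.
      * now apply (Hout v (Imp A B)).
  - rewrite HR; split.
    + intros [H1 H2] r Hr HA.
      assert (Hwr : le w r) by (eapply le_trans; eauto).
      destruct (classic (forces V r P)) as [HPr|HPr].
      * apply forces_pull_theta in HA; auto.
        apply (Hin r _ Hwr HPr HC H2 r (le_refl r) HA).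
      * apply H1, (IHA HL r); auto.
    + intros H; split.
      * intros HA; apply (H v (le_refl v)), (IHA HL v); auto.
      * now apply (Hout v (Neg A)). }
apply forces_typed_in; intros v Hv.
destruct (classic (forces V v P)) as [HPv|HPv].
- destruct (HP v HPv) as [u [Hu HT]]; exists u; split; [exact Hu|].
  intros C HC; rewrite (HT C HC); symmetry; now apply forces_pull_theta.
- exists t; split; [exact Ht|]; intros C HC; now apply Htype.
Qed.

End Step.

Definition iter_theta (P : form) {F : frame} (ts : list (list form)) (V : F -> nat -> Prop) :
    F -> nat -> Prop :=
  fold_left (fun V t => pull (theta P t) V) ts V.

Lemma iter_theta_persistent (P : form) {F : frame} (ts : list (list form))
    (V : F -> nat -> Prop) :
  persistent V -> persistent (iter_theta P ts V).
Proof.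
revert V; induction ts as [|t ts IH]; intros V HV; [exact HV|].
apply IH, pull_persistent, HV.
Qed.

Lemma forces_iter_theta (P : form) {F : frame} (ts : list (list form))
    (V : F -> nat -> Prop) (w : F) (A : form) :
  persistent V -> forces V w P -> (forces (iter_theta P ts V) w A <-> forces V w A).
Proof.
revert V; induction ts as [|t ts IH]; intros V HV HP; [reflexivity|].
simpl; rewrite IH.
- now apply forces_pull_theta.
- now apply pull_persistent.
- now apply forces_pull_theta.
Qed.

Lemma seen_iter_theta (L : list form) (X : list (list form)) {F : frame}
    (ts : list (list form)) (V : F -> nat -> Prop) (w : F) (t : list form) :
  persistent V -> seen L X V w t -> seen L X (iter_theta (typed_in L X) ts V) w t.
Proof.
revert V; induction ts as [|s ts IH]; intros V HV H; [exact H|].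
simpl; apply IH; [now apply pull_persistent|now apply seen_pull].
Qed.

(** The head is substituted outermost, because valuations pull back in the opposite order; this
    matches [iter_theta], which pulls along the head first. *)
Fixpoint iter_subst (P : form) (ts : list (list form)) (n : nat) : form :=
  match ts with
  | [] => Var n
  | t :: ts => subst (theta P t) (iter_subst P ts n)
  end.

Lemma forces_iter_subst (P : form) {F : frame} (ts : list (list form))
    (V : F -> nat -> Prop) (w : F) (A : form) :
  forces V w (subst (iter_subst P ts) A) <-> forces (iter_theta P ts V) w A.
Proof.
rewrite forces_subst; revert V w A; induction ts as [|t ts IH]; intros V w A; [reflexivity|].
simpl; rewrite <- IH; apply forces_agree; intros v n _.
unfold pull at 1; simpl; apply forces_subst.
Qed.

(* A world [w] that sees only [m] types before and after the round shares them
   with every world above it refuting [P]; so [theta_step] applies at the moment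
   of the round when the root type for these types has its turn. *)
Lemma theta_round (L Gamma : list form) (X : list (list form)) {F : frame}
    (V : F -> nat -> Prop) (m : nat) :
  closed L -> extendible L Gamma X -> persistent V ->
  let P := typed_in L X in
  let V' := iter_theta P X V in
  (forall w, ~ forces V w P -> m <= length (cfilter (seen L X V w) X)) ->
  forall w, ~ forces V' w P -> S m <= length (cfilter (seen L X V' w) X).
Proof.
intros HL HX HV P V' Hm w Hw.
destruct (Nat.le_gt_cases (S m) (length (cfilter (seen L X V' w) X))) as [|Hlt]; [assumption|].
contradict Hw.
assert (HVV' : forall x t, seen L X V x t -> seen L X V' x t)
  by (intros x t; now apply seen_iter_theta).
(* [t] is a root type for what [w] sees before the round; splitting [X] at [t] isolates the
   valuation [V1] at its turn. *)
destruct (proj2 HX (seen L X V w)) as [t [Ht Hroot]]; [now intros u []|].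
destruct (in_split t X Ht) as [X1 [X2 HX12]].
set (V1 := iter_theta P X1 V).
assert (HV1 : persistent V1) by now apply iter_theta_persistent.
assert (EV' : V' = iter_theta P X2 (pull (theta P t) V1)).
{ unfold V', V1, iter_theta; rewrite HX12 at 1; now rewrite fold_left_app. }
assert (H01 : forall x u, seen L X V x u -> seen L X V1 x u)
  by (intros x u; now apply seen_iter_theta).
assert (H1' : forall x u, seen L X V1 x u -> seen L X V' x u).
{ intros x u H; rewrite EV'; apply seen_iter_theta.
  - now apply pull_persistent.
  - now apply seen_pull. }
destruct (classic (forces V w P)) as [HP|HP]; [now apply forces_iter_theta|].
(* Before the round [x] sees at least [m] types, all of them seen by [w] after it, and [w] then sees
   at most [m]; hence the two sets coincide. *)
assert (Hback : forall x, le w x -> ~ forces V x P ->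
  forall u, seen L X V' w u -> seen L X V x u).
{ intros x Hx HPx u Hu.
  apply (length_cfilter_eq (seen L X V x) (seen L X V' w) X).
  - intros y Hy; apply HVV'; eapply seen_anti; eauto.
  - specialize (Hm x HPx); lia.
  - apply Hu.
  - exact Hu. }
assert (Hstep : forces (pull (theta P t) V1) w P).
{ apply theta_step; auto.
  - intros v Hv HPv u Hu; apply H01, Hback; auto.
    intros HPv0; apply HPv; now apply forces_iter_theta.
  (* By [Hback], [w] sees the same types under [V1] as under [V], so [t] is still a root type for
     them. *)
  - intros C HC; specialize (Hroot C HC).
    assert (E : (forall u, seen L X V w u -> In C u) <-> (forall u, seen L X V1 w u -> In C u)).
    { split; intros H u Hu; apply H; auto.
      apply Hback; auto using le_refl. }
    destruct C; try rewrite <- E; tauto. }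
rewrite EV'; apply forces_iter_theta; auto using pull_persistent.
Qed.

(** Each pass through [X] raises by one the least number of types a refuting world can see. *)
Lemma theta_rounds (L Gamma : list form) (X : list (list form)) {F : frame}
    (V : F -> nat -> Prop) (k m : nat) :
  closed L -> extendible L Gamma X -> persistent V ->
  let P := typed_in L X in
  let V' := iter_theta P (concat (repeat X k)) V in
  (forall w, ~ forces V w P -> m <= length (cfilter (seen L X V w) X)) ->
  forall w, ~ forces V' w P -> k + m <= length (cfilter (seen L X V' w) X).
Proof.
intros HL HX; revert V m; induction k as [|k IH]; intros V m HV P V' Hm w Hw; [auto|].
unfold V' in *; simpl in *; unfold iter_theta in *; rewrite fold_left_app in *.
rewrite plus_n_Sm; apply IH; auto.
- now apply iter_theta_persistent.
- now apply theta_round with Gamma.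
Qed.

Lemma typed_in_projective (L Gamma : list form) (X : list (list form)) :
  closed L -> extendible L Gamma X ->
  exists s, logic IPC (subst s (typed_in L X)) /\
  forall A, derives IPC [typed_in L X; subst s A] A.
Proof.
intros HL HX; set (P := typed_in L X).
(* After one round more than [X] has entries, a refuting world would see more types than [X]
   offers. *)
exists (iter_subst P (concat (repeat X (S (length X))))); split.
- apply ipc_complete; intros F V w HV _; apply forces_iter_subst, NNPP; intros HN.
  apply (theta_rounds L Gamma X V (S (length X)) 0) in HN; auto with arith.
  pose proof (length_cfilter_le
    (seen L X (iter_theta P (concat (repeat X (S (length X)))) V) w) (fun _ => True) X
    (fun _ _ => I)) as Hle.
  assert (E : length (cfilter (fun _ : list form => True) X) <= length X)
    by apply filter_length_le.
  fold P in HN; lia.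
- intros A; apply ipc_complete; intros F V w HV HG.
  assert (HP : forces V w P) by (apply HG; now left).
  apply (forces_iter_theta P (concat (repeat X (S (length X)))) V w A HV HP).
  apply forces_iter_subst, HG; now right; left.
Qed.

(** * Unifiers and gluing *)

Record model : Type := Model {
  m_frame :> frame;
  m_val : m_frame -> nat -> Prop;
  m_persistent : persistent m_val;
  m_root : m_frame
}.

Section Glue.
Variables (I : Type) (M : I -> model).

(** [None] is the new root, placed below the worlds above each [m_root]. *)
Definition glue_le (v w : option {i : I & M i}) : Prop :=
  match v, w with
  | None, None => True
  | None, Some (existT _ i y) => le (m_root (M i)) y
  | Some _, None => False
  | Some x, Some y => exists i a b, x = existT _ i a /\ y = existT _ i b /\ le a b
  end.

Definition glue_frame : frame.
Proof.
refine (Frame (option {i : I & M i}) glue_le _ _).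
- intros [[i a]|]; simpl; [|exact Logic.I].
  exists i, a, a; repeat split; apply le_refl.
- intros [x|] [y|] [z|]; simpl; try tauto.
  + intros [i [a [b [-> [-> Hab]]]]] [j [c [d [E [-> Hcd]]]]].
    assert (Hji : j = i) by (injection E; auto); subst j.
    apply inj_pair2 in E; subst c.
    exists i, a, d; repeat split; eapply le_trans; eauto.
  + destruct y as [i a]; intros Ha [j [c [d [E [-> Hcd]]]]].
    assert (Hji : j = i) by (injection E; auto); subst j.
    apply inj_pair2 in E; subst c.
    eapply le_trans; eauto.
Defined.

(** The new root forces no variable, so persistence holds whatever models are glued. *)
Definition glue_val : glue_frame -> nat -> Prop :=
  fun w n => match w with Some (existT _ i a) => m_val (M i) a n | None => False end.

Lemma glue_le_some (i : I) (a : M i) (w : glue_frame) :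
  le (Some (existT _ i a) : glue_frame) w <-> exists b, w = Some (existT _ i b) /\ le a b.
Proof.
split.
- destruct w as [y|]; simpl; [|tauto].
  intros [j [c [d [E [-> Hcd]]]]].
  assert (Hji : j = i) by (injection E; auto); subst j.
  apply inj_pair2 in E; subst c; eauto.
- intros [b [-> Hb]]; simpl; exists i, a, b; auto.
Qed.

Lemma glue_persistent : persistent glue_val.
Proof.
intros [[i a]|] w n H; [|simpl; tauto].
apply glue_le_some in H as [b [-> Hb]]; now apply m_persistent.
Qed.

Lemma forces_glue (i : I) (a : M i) (A : form) :
  forces glue_val (Some (existT _ i a) : glue_frame) A <-> forces (m_val (M i)) a A.
Proof.
revert a; induction A as [n|A IHA B IHB|A IHA B IHB|A IHA B IHB|A IHA]; intros a;
  cbn [forces].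
- reflexivity.
- now rewrite IHA, IHB.
- now rewrite IHA, IHB.
- split.
  + intros H b Hb HA; apply IHB, H, IHA, HA; apply glue_le_some; eauto.
  + intros H w Hw HA; apply glue_le_some in Hw as [b [-> Hb]]; apply IHB, H, IHA; auto.
- split.
  + intros H b Hb HA; apply (H (Some (existT _ i b))), IHA, HA; apply glue_le_some; eauto.
  + intros H w Hw HA; apply glue_le_some in Hw as [b [-> Hb]]; apply (H b), IHA; auto.
Qed.

Lemma glue_le_none (w : glue_frame) :
  le (None : glue_frame) w <->
  w = None \/ exists i a, w = Some (existT _ i a) /\ le (m_root (M i)) a.
Proof.
destruct w as [[i a]|]; simpl; split; auto.
- intros H; right; eauto.
- intros [H|[j [b [E H]]]]; [discriminate|].
  assert (Hji : j = i) by (injection E; auto); subst j.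
  injection E as E; apply inj_pair2 in E; now subst.
Qed.

End Glue.

Definition realised (L : list form) (s : nat -> form) : list (list form) :=
  cfilter (fun t => exists M : model, has_type L (pull s (m_val M)) (m_root M) t) (sublists L).

(** Glue one model for each type in [Y]. Pulled back along [s], the new root has a type again
    realised through [s], and by construction it is a root type for [Y]. Soundness places [Gamma] in
    every realised type. *)
Lemma realised_extendible (L Gamma : list form) (s : nat -> form) :
  closed L -> incl Gamma L -> (forall G, In G Gamma -> logic IPC (subst s G)) ->
  extendible L Gamma (realised L s).
Proof.
intros HL HGL HG; split.
- intros t Ht G HGG; apply in_cfilter in Ht as [_ [M HT]].
  apply HT; [now apply HGL|]; apply forces_subst.
  apply (ipc_sound [] (subst s G)); [now apply HG|apply m_persistent|intros A []].
- intros Y HY.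
  assert (HM : forall u : {u | Y u}, exists M : model,
    has_type L (pull s (m_val M)) (m_root M) (proj1_sig u)).
  { intros [u Hu]; exact (proj2 (proj1 (in_cfilter _ _ _) (HY u Hu))). }
  apply functional_choice in HM as [M HM].
  pose (V := pull s (glue_val _ M)).
  assert (HV : persistent V) by apply pull_persistent, glue_persistent.
  assert (Hsome : forall i a A, forces V (Some (existT _ i a) : glue_frame _ M) A <->
    forces (pull s (m_val (M i))) a A).
  { intros i a A; unfold V; rewrite <- !forces_subst; apply forces_glue. }
  pose (r := None : glue_frame _ M).
  pose (b i := Some (existT _ i (m_root (M i))) : glue_frame _ M).
  assert (Hb : forall i C, In C L -> (forces V (b i) C <-> In C (proj1_sig i))).
  { intros i C HC; unfold b; rewrite Hsome; symmetry; now apply HM. }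
  assert (Hrb : forall i, le r (b i)) by (intros i; apply (le_refl (m_root (M i)))).
  (* Implications and negations at the root thus split into a condition at the root itself and
     membership in every type of [Y]. *)
  assert (Hrw : forall w, le r w -> w = r \/ exists i, le (b i) w).
  { intros w Hw; apply glue_le_none in Hw as [->|[i [a [-> Ha]]]]; [now left|right].
    exists i; apply glue_le_some; eauto. }
  assert (Hpers : forall C, In C L -> forces V r C -> forall u, Y u -> In C u).
  { intros C HC HF u Hu; apply (Hb (exist _ u Hu) C HC).
    now apply forces_mono with r. }
  exists (type_at L V r); split.
  + apply in_cfilter; split; [apply cfilter_sublists|].
    exists (Model _ (glue_val _ M) (glue_persistent _ M) r); apply has_type_at.
  + assert (HT : has_type L V r (type_at L V r)) by apply has_type_at.
    intros C HC; pose proof (HL C HC) as HS.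
    destruct C as [n|A B|A B|A B|A]; cbv beta iota in HS;
      try rewrite (HT A (proj1 HS)), (HT B (proj2 HS));
      rewrite (HT _ HC).
    * now apply Hpers.
    * reflexivity.
    * reflexivity.
    * split.
      -- intros HF; split; [apply HF, le_refl|now apply Hpers].
      -- intros [H1 H2] w Hw HA; destruct (Hrw w Hw) as [->|[i Hi]]; [auto|].
         refine (_ w Hi HA); apply (Hb i (Imp A B) HC), H2, (proj2_sig i).
    * rewrite (HT A HS); split.
      -- intros HF; split; [apply HF, le_refl|now apply Hpers].
      -- intros [H1 H2] w Hw; destruct (Hrw w Hw) as [->|[i Hi]]; [auto|].
         refine (_ w Hi); apply (Hb i (Neg A) HC), H2, (proj2_sig i).
Qed.

Lemma realised_typed_in (L : list form) (s : nat -> form) (F : frame)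
    (V : F -> nat -> Prop) (w : F) :
  persistent V -> forces (pull s V) w (typed_in L (realised L s)).
Proof.
intros HV; apply forces_typed_in; intros v _.
exists (type_at L (pull s V) v); split; [|apply has_type_at].
apply in_cfilter; split; [apply cfilter_sublists|].
exists (Model F V HV v); apply has_type_at.
Qed.

(** * Projective approximations and structural completeness *)

Definition approximations (Gamma : list form) : list form :=
  let L := closure Gamma in
  map (typed_in L) (cfilter (extendible L Gamma) (sublists (sublists L))).

Lemma approximation_projective (Gamma : list form) (P : form) :
  In P (approximations Gamma) ->
  (forall G, In G Gamma -> derives IPC [P] G) /\
  exists s, logic IPC (subst s P) /\ forall A, derives IPC [P; subst s A] A.
Proof.
intros HP; apply in_map_iff in HP as [X [<- HX]]; apply in_cfilter in HX as [_ HX].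
split; [|apply typed_in_projective with Gamma; [apply closed_closure|exact HX]].
intros G HG; apply ipc_complete; intros F V w HV HF.
destruct (proj1 (forces_typed_in _ _ V w) (HF _ (or_introl eq_refl)) w (le_refl w))
  as [t [Ht HT]].
apply HT; [now apply incl_closure|now apply HX].
Qed.

(** For a unifier [s] of [Gamma], the disjunct given by the types realised through [s] becomes a
    theorem under [s]. *)
Lemma approximations_admissible (Gamma : list form) :
  admissible IPC (Gamma, bigor (approximations Gamma)).
Proof.
apply admissible_iff; intros s HG.
set (L := closure Gamma).
apply ipc_complete; intros F V w HV _.
apply forces_subst, forces_bigor.
exists (typed_in L (realised L s)); split; [|now apply realised_typed_in].
apply in_map, in_cfilter; split; [apply cfilter_sublists|].
apply realised_extendible; [apply closed_closure|apply incl_closure|exact HG].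
Qed.

Lemma ipc_bigor_elim (l : list form) (B : form) :
  derives IPC (bigor l :: map (fun P => Imp P B) l) B.
Proof.
apply ipc_complete; intros F V w HV HF.
destruct (proj1 (forces_bigor V w l) (HF _ (or_introl eq_refl))) as [P [HP HwP]].
refine (HF (Imp P B) (or_intror _) w (le_refl w) HwP).
now apply (in_map (fun P => Imp P B)).
Qed.

Lemma extension_structurally_complete (S : system) :
  deductive_extension (structural_completion IPC) S -> structurally_complete S.
Proof.
intros HS [Gamma B] Hadm; unfold derivable; simpl.
assert (HI : forall Delta A, derives IPC Delta A -> derives S Delta A).
{ intros Delta A HA; apply HS; revert HA; apply derives_rules_mono; [auto|].
  intros r Hr; exact (rules_admissible IPC r Hr). }
rewrite admissible_iff in Hadm.
apply derives_cut with (bigor (approximations Gamma) ::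
  map (fun P => Imp P B) (approximations Gamma)); [|apply HI, ipc_bigor_elim].
intros D [<-|HD].
- apply HS.
  (* The admissible rule is a rule of the completion; it is used under the identity substitution
     [Var]. *)
  pose proof (derives_rule (structural_completion IPC) Gamma Var Gamma
    (bigor (approximations Gamma)) (approximations_admissible Gamma)) as H.
  assert (E : forall A, subst Var A = A) by (induction A; simpl; congruence).
  rewrite E in H; apply H; intros G HG; rewrite E; now apply derives_hyp.
- apply in_map_iff in HD as [P [<- HP]].
  destruct (approximation_projective Gamma P HP) as [HPG [s [HsP Hproj]]].
  (* The projective unifier [s] of [P] also unifies [Gamma], since [P] entails [Gamma];
     admissibility of the rule in [S] then yields the conclusion under [s]. *)
  assert (HsB : logic S (subst s B)).
  { apply Hadm; intros G HG; apply HI.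
    apply derives_cut with [subst s P]; [intros C [<-|[]]; exact HsP|].
    apply ipc_complete; intros F V w HV HF; apply forces_subst.
    apply (ipc_sound [P] G (HPG G HG)); [now apply pull_persistent|].
    intros C [<-|[]]; apply forces_subst, HF; now left. }
  apply derives_cut with [subst s B].
  + intros C [<-|[]]; apply derives_incl with []; [intros x []|exact HsB].
  + apply HI, ipc_imp_intro, Hproj.
Qed.

Theorem theorem5p1 :
  hereditarily_structurally_complete (structural_completion IPC).
Proof.
split; [|exact extension_structurally_complete].
apply extension_structurally_complete; intros Gamma A HA; exact HA.
Qed.
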